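(* There is a constant $c>0$ such that for every function $d(n)$ with $c\ln^2 n\le d(n)=\log^{O(1)} n$, the problem of computing a $d(n)$-diameter ordering of an $n$-node graph $G$ is $\mathsf{P}\text{-}\mathsf{SLOCAL}$-complete.
   Context: Distributed graph problems: the input graph $G=(V,E)$ with $n$ nodes is also the communication network; nodes have unique identifiers (of $O(\log n)$ bits) and possibly local inputs, and each node must produce a local output; the problem specifies which collections of outputs are valid. LOCAL model: computation proceeds in synchronous rounds; in each round every node performs arbitrary local computation, sends a message of arbitrary size to each neighbor and receives its neighbors' messages. $\mathsf{LOCAL}(t)$ is the class of problems solvable deterministically in $t$ rounds. SLOCAL model: the nodes are processed sequentially in an arbitrary order. When a node $v$ is processed, it can read the current state of all nodes in its $r$-hop neighborhood (their initial inputs and everything stored by previously processed nodes), and computes its output as an arbitrary function of this; it may additionally store an arbitrary amount of information in its own state, readable by later processed nodes. $r$ is the locality. $\mathsf{SLOCAL}(t)$ is the class of problems solvable deterministically with locality $t$ (correct for every processing order). $\mathsf{P}\text{-}\mathsf{LOCAL} := \mathsf{LOCAL}(\log^{O(1)} n)$, $\mathsf{P}\text{-}\mathsf{SLOCAL} := \mathsf{SLOCAL}(\log^{O(1)} n)$. $\mathcal{P}_1$ is polylog-reducible to $\mathcal{P}_2$ if a deterministic polylog-round LOCAL algorithm for $\mathcal{P}_2$ implies one for $\mathcal{P}_1$. $\mathcal{P}$ is $\mathsf{P}\text{-}\mathsf{SLOCAL}$-complete if $\mathcal{P}\in\mathsf{P}\text{-}\mathsf{SLOCAL}$ and every problem in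 $\mathsf{P}\text{-}\mathsf{SLOCAL}$ is polylog-reducible to $\mathcal{P}$. Low diameter ordering: given an $n$-node graph $G=(V,E)$, a $d(n)$-diameter ordering of $G$ is an assignment of unique labels to all nodes of $V$ such that for every path $P$ in $G$ along which the labels are increasing, any two nodes of $P$ are within distance $d(n)$ in $G$. *)

(* Defs.v *)
From HB Require Import structures.
From mathcomp Require Import all_boot all_order all_algebra.
From mathcomp Require Import all_classical all_reals all_analysis.
Set Implicit Arguments.
Unset Strict Implicit.
Unset Printing Implicit Defensive.
Import Order.TTheory GRing.Theory Num.Theory.
Local Open Scope ring_scope.

Record sgraph := SGraph {
  vertex :> finType;
  adj : rel vertex;
  adj_sym : symmetric adj;
  adj_irr : irreflexive adj }.

(* The distance from u to v is at most r (false if u and v are disconnected). *)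
Definition within (G : sgraph) (r : nat) (u v : G) : bool :=
  [exists k : 'I_r.+1, exists p : k.-tuple G,
     path (@adj G) u p && (last u p == v)].

(* Identifiers of at most a * log2 n bits. *)
Definition valid_ids (a : nat) (G : sgraph) (id : G -> nat) : Prop :=
  injective id /\ forall v : G, (id v < #|G| ^ a)%N.

(* The function of type G -> nat is the identifier assignment, so that outputs
   may refer to identifiers (as in "output the identifier of a neighbor"). A
   restriction to certain inputs is expressed by accepting every output on the
   other ones. *)
Record problem := Problem {
  input : Type;
  output : Type;
  valid : forall G : sgraph,
    (G -> nat) -> (G -> input) -> (G -> output) -> Prop }.

(** * The LOCAL model *)

(* A node starts with the number of nodes, its own identifier and its input.
   In each round, [lsend s j] is the message that a node in state s sends to
   its neighbor with identifier j, if there is one. [lrecv s m] is the next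
   state, where m maps the identifier of each neighbor to the message received
   from it, and every other number to None. *)
Record local_alg (I O : Type) := LocalAlg {
  lstate : Type;
  lmsg : Type;
  linit : nat -> nat -> I -> lstate;
  lsend : lstate -> nat -> lmsg;
  lrecv : lstate -> (nat -> option lmsg) -> lstate;
  lout : lstate -> O }.

Definition local_round (I O : Type) (A : local_alg I O) (G : sgraph)
    (id : G -> nat) (s : G -> lstate A) : G -> lstate A :=
  fun v => lrecv (s v) (fun j =>
    omap (fun w : G => lsend (s w) (id v)) [pick w | adj v w & id w == j]).

Definition local_run (I O : Type) (A : local_alg I O) (G : sgraph)
    (id : G -> nat) (x : G -> I) (t : nat) : G -> lstate A :=
  iter t (local_round id) (fun v => linit A #|G| (id v) (x v)).

Definition LOCAL (a : nat) (t : nat -> nat) (P : problem) : Prop :=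
  exists A : local_alg (input P) (output P),
    forall (G : sgraph) (id : G -> nat) (x : G -> input P),
      valid_ids a id ->
      valid id x (fun v => lout (local_run A id x (t #|G|) v)).

(** * The SLOCAL model *)

(* The subgraph induced by the r-hop neighborhood of a node, with vertices named
   by their identifiers. [view_node j] is None if the neighborhood has no node
   with identifier j; otherwise it is the input of that node, together with its
   output and what it stored if it has been processed. *)
Record view (I O M : Type) := View {
  view_center : nat;
  view_node : nat -> option (I * option (O * M));
  view_edge : rel nat }.

Record slocal_alg (I O : Type) := SlocalAlg {
  smem : Type;
  sstep : nat -> view I O smem -> O * smem }.

Definition view_of (I O M : Type) (G : sgraph) (id : G -> nat) (x : G -> I)
    (r : nat) (m : G -> option (O * M)) (v : G) : view I O M :=
  View (id v)
    (fun j => omap (fun w : G => (x w, m w)) [pick w | within r v w & id w == j])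
    (fun j k => [exists u : G, exists w : G,
       [&& within r v u, within r v w, adj u w, id u == j & id w == k]]).

Definition slocal_step (I O : Type) (A : slocal_alg I O) (G : sgraph)
    (id : G -> nat) (x : G -> I) (r : nat)
    (m : G -> option (O * smem A)) (v : G) : G -> option (O * smem A) :=
  fun w => if w == v then Some (sstep #|G| (view_of id x r m v)) else m w.

(* The nodes are processed from the head of [order] to its end. *)
Definition slocal_run (I O : Type) (A : slocal_alg I O) (G : sgraph)
    (id : G -> nat) (x : G -> I) (r : nat) (order : seq G) :
    G -> option (O * smem A) :=
  foldl (slocal_step id x r) (fun=> None) order.

Definition SLOCAL (a : nat) (t : nat -> nat) (P : problem) : Prop :=
  exists A : slocal_alg (input P) (output P),
    forall (G : sgraph) (id : G -> nat) (x : G -> input P) (order : seq G),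
      valid_ids a id ->
      perm_eq order (enum G) ->
      exists y : G -> output P,
        (forall v, omap fst (slocal_run A id x (t #|G|) order v) = Some (y v))
        /\ valid id x y.

(** * Complexity classes, reductions and completeness *)

(* f(n) = log^{O(1)} n. *)
Definition polylog (R : realType) (f : nat -> R) : Prop :=
  exists k : nat, \forall n \near \oo%classic, f n <= ln n%:R ^+ k.

Definition P_LOCAL (R : realType) (a : nat) (P : problem) : Prop :=
  exists t : nat -> nat, polylog (fun n => (t n)%:R : R) /\ LOCAL a t P.

Definition P_SLOCAL (R : realType) (a : nat) (P : problem) : Prop :=
  exists t : nat -> nat, polylog (fun n => (t n)%:R : R) /\ SLOCAL a t P.

Definition polylog_reducible (R : realType) (a : nat) (P1 P2 : problem) : Prop :=
  P_LOCAL R a P2 -> P_LOCAL R a P1.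

Definition P_SLOCAL_complete (R : realType) (a : nat) (P : problem) : Prop :=
  P_SLOCAL R a P /\
  forall Q : problem, P_SLOCAL R a Q -> polylog_reducible R a Q P.

(** * Low diameter orderings *)

Definition diameter_ordering (R : realType) (D : R) (G : sgraph)
    (lab : G -> nat) : Prop :=
  injective lab /\
  forall (u : G) (p : seq G),
    path (@adj G) u p -> sorted ltn (map lab (u :: p)) ->
    {in u :: p &, forall v w, exists2 k : nat, k%:R <= D & within k v w}.

Definition diameter_ordering_problem (R : realType) (d : nat -> R) : problem :=
  @Problem unit nat (fun G _ _ lab => diameter_ordering (d #|G|) lab).

(* Main.v *)
(* Membership: a sequential ball carving. Every node carries a level, initially
   0. A cluster of color i is grown inside the unclustered nodes of level i until
   its boundary is no larger than the cluster itself, which happens within radius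
   log2 n; the boundary moves to level i + 1. A cluster may only be carved where
   no adjacent unclustered node has a lower level. Then clusters of equal color
   are never adjacent, and at most half of the nodes of level at least i ever
   reach level i + 1, so that there are at most log2 n + 1 colors. The label of a
   node is its color followed by its identifier: an increasing path crosses at
   most one cluster of each color, hence spans a distance O(log^2 n).

   Hardness: run the ordering algorithm on the power graph G^r, where r is the
   locality of an SLOCAL algorithm, and simulate that algorithm in the order of
   the labels. A node depends on another one only through a label-decreasing path
   of G^r, so all its dependencies are within distance r d(n) in G. *)

Require Import Defs.
From mathcomp Require Import all_boot all_order all_algebra zify lra.
From mathcomp Require Import all_classical all_reals all_analysis.
Import Order.TTheory GRing.Theory Num.Theory.
Local Open Scope ring_scope.

Set Implicit Arguments.
Unset Strict Implicit.
Unset Printing Implicit Defensive.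

(** * Walks of bounded length *)

Section Reach.
Context {T : Type} (e : rel T).

Definition reach (r : nat) (u v : T) : Prop :=
  exists p : seq T, [/\ path e u p, last u p = v & (size p <= r)%N].

Lemma reach_refl r u : reach r u u.
Proof. by exists [::]. Qed.

Lemma reach1 u v : e u v -> reach 1 u v.
Proof. by move=> uv; exists [:: v]; split=> //=; rewrite uv. Qed.

Lemma reach_leq r s u v : (r <= s)%N -> reach r u v -> reach s u v.
Proof. by move=> rs [p [ep lp sp]]; exists p; split=> //; exact: leq_trans rs. Qed.

Lemma reach_trans r s u v w :
  reach r u v -> reach s v w -> reach (r + s) u w.
Proof.
move=> [p [ep lp sp]] [q [eq lq sq]]; exists (p ++ q).
by rewrite cat_path last_cat size_cat lp ep eq leq_add.
Qed.

Lemma reach_sym r u v : symmetric e -> reach r u v -> reach r v u.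
Proof.
move=> es [p [ep lp sp]]; exists (rev (belast u p)); split.
- rewrite -lp rev_path; apply: sub_path ep => x y; by rewrite es.
- by case: p {ep sp} lp => [|x p] //= lp; rewrite rev_cons last_rcons.
- by rewrite size_rev size_belast.
Qed.

End Reach.

Lemma sub_reach (T : Type) (e e' : rel T) r u v :
  subrel e e' -> reach e r u v -> reach e' r u v.
Proof. by move=> ee [p [ep lp sp]]; exists p; split=> //; exact: sub_path ep. Qed.

Lemma withinP (G : sgraph) r (u v : G) :
  reflect (reach (@adj G) r u v) (Defs.within r u v).
Proof.
apply: (iffP existsP) => [[k /existsP[p /andP[ep /eqP lp]]]|[p [ep lp sp]]].
  by exists p; split=> //; rewrite size_tuple -ltnS.
have sp' : (size p < r.+1)%N by [].
exists (Ordinal sp'); apply/existsP; exists (in_tuple p).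
by rewrite /= ep lp eqxx.
Qed.

(** * Simulating SLOCAL algorithms *)

(** The states of the full-information protocol: every node forwards all it knows, so after k rounds
    it holds the depth-k unfolding of the network around itself, with children indexed by
    identifiers. *)
Inductive knowledge_tree (I : Type) : Type :=
  Known of nat & nat & I & (nat -> option (knowledge_tree I)).

Definition gather (I O : Type) (out : knowledge_tree I -> O) : local_alg I O :=
  @LocalAlg I O (knowledge_tree I) (knowledge_tree I)
    (fun n i x => Known n i x (fun=> None))
    (fun s _ => s)
    (fun s m => let: Known n i x _ := s in Known n i x m)
    out.

Definition knowledge (I : Type) (G : sgraph) (id : G -> nat) (x : G -> I)
    (k : nat) (u : G) : knowledge_tree I :=
  local_run (gather idfun) id x k u.

Section Knowledge.
Context {I : Type} {G : sgraph} (id : G -> nat) (x : G -> I).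

Lemma knowledge_recv k u : knowledge id x k.+1 u =
  lrecv (knowledge id x k u : lstate (gather idfun)) (fun j =>
    omap (knowledge id x k) [pick w | adj u w & id w == j]).
Proof. by []. Qed.

Lemma knowledge_root k u :
  exists c, knowledge id x k u = Known #|G| (id u) (x u) c.
Proof.
elim: k => [|k [c IH]]; first by eexists.
by rewrite knowledge_recv IH; eexists.
Qed.

Lemma knowledgeS k u : knowledge id x k.+1 u =
  Known #|G| (id u) (x u) (fun j =>
    omap (knowledge id x k) [pick w | adj u w & id w == j]).
Proof.
rewrite knowledge_recv.
by have [c ->] := knowledge_root k u.
Qed.

End Knowledge.

(** The picks range over different graphs. Matching witnesses by identifier in both directions, with
    [id'] injective, makes both fail or both return corresponding nodes. *)
Lemma eq_omap_pick (G G' : finType) (id : G -> nat) (id' : G' -> nat)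
    (P : pred G) (P' : pred G') (T : Type) (f : G -> T) (g : G' -> T) j :
  injective id' ->
  (forall w, P w -> id w = j -> exists w', [/\ P' w', id' w' = j & f w = g w']) ->
  (forall w', P' w' -> id' w' = j -> exists2 w, P w & id w = j) ->
  omap f [pick w | P w & id w == j] = omap g [pick w | P' w & id' w == j].
Proof.
move=> inj PP' P'P.
case: pickP => [w /andP[Pw /eqP idw]|nP]; case: pickP => [w' /andP[Pw' /eqP idw']|nP'] //=.
- have [w'' [_ idw'' ->]] := PP' w Pw idw.
  by congr (Some (g _)); apply: inj; rewrite idw'.
- have [w'' [Pw'' idw'' _]] := PP' w Pw idw.
  by have := nP' w''; rewrite Pw'' idw'' eqxx.
- have [w'' Pw'' idw''] := P'P w' Pw' idw'.
  by have := nP w''; rewrite Pw'' idw'' eqxx.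
Qed.

Lemma eq_omap_pick_some (G G' : finType) (id : G -> nat) (id' : G' -> nat)
    (P : pred G) (P' : pred G') (T : Type) (f : G -> T) (g : G' -> T) w :
  injective id ->
  omap f [pick z | P z & id z == id w] = omap g [pick z | P' z & id' z == id w] ->
  P w -> exists w', [/\ P' w', id' w' = id w & f w = g w'].
Proof.
move=> inj; case: pickP => [z /andP[_ /eqP/inj ->]|nP]; last first.
  by move=> _ Pw; have := nP w; rewrite Pw eqxx.
by case: pickP => [z' /andP[P'z /eqP idz]|//] [fg] _; exists z'.
Qed.

Section KnowledgePair.
Context {I : Type} {G G' : sgraph} (id : G -> nat) (id' : G' -> nat).
Context (x : G -> I) (x' : G' -> I).
Hypothesis id_inj : injective id.

Lemma knowledge_eq_root k u u' : knowledge id x k u = knowledge id' x' k u' ->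
  [/\ #|G| = #|G'|, id u = id' u' & x u = x' u'].
Proof.
have [c ->] := knowledge_root id x k u.
by have [c' ->] := knowledge_root id' x' k u' => -[].
Qed.

Lemma knowledge_eq_adj k u u' w :
  knowledge id x k.+1 u = knowledge id' x' k.+1 u' -> adj u w ->
  exists2 w', adj u' w' & knowledge id x k w = knowledge id' x' k w'.
Proof.
rewrite !knowledgeS => -[_ _ _ ch] uw.
have [w' [? _ ?]] := eq_omap_pick_some id_inj (congr1 (@^~ (id w)) ch) uw.
by exists w'.
Qed.

Lemma knowledge_eq_pred k u u' :
  knowledge id x k.+1 u = knowledge id' x' k.+1 u' ->
  knowledge id x k u = knowledge id' x' k u'.
Proof.
elim: k u u' => [|k IH] u u'.
  by move=> /knowledge_eq_root[nn ii xx]; rewrite /knowledge /local_run /= nn ii xx.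
rewrite !knowledgeS => -[-> -> -> ch].
congr Known; apply/funext => j; have := congr1 (@^~ j) ch => /=.
case: pickP => [w _|_]; case: pickP => [w' _|_] //= [].
by move/IH ->.
Qed.

Lemma knowledge_eq_leq k l u u' : (k <= l)%N ->
  knowledge id x l u = knowledge id' x' l u' ->
  knowledge id x k u = knowledge id' x' k u'.
Proof.
move=> /subnK <-; elim: (l - k)%N => [//|m IH].
by rewrite addSn => /knowledge_eq_pred.
Qed.

(** Each step of a walk descends into one child and uses up one level of depth. *)
Lemma knowledge_eq_reach k r u u' w :
  knowledge id x (k + r) u = knowledge id' x' (k + r) u' ->
  reach (@adj G) r u w ->
  exists2 w', reach (@adj G') r u' w' & knowledge id x k w = knowledge id' x' k w'.
Proof.
move=> + [p [+ <- +]]; elim: p r u u' => [|z p IH] r u u' /=.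
  move=> kn _ _; exists u'; first exact: reach_refl.
  by apply: knowledge_eq_leq kn; rewrite leq_addr.
case: r => // r; rewrite addnS ltnS => kn /andP[uz zp] sp.
have [z' uz' knz] := knowledge_eq_adj kn uz.
have [w' zw' knw] := IH _ _ _ knz zp sp.
by exists w' => //; rewrite -add1n; apply: reach_trans zw'; exact: reach1.
Qed.

End KnowledgePair.

(** Equal knowledge has to force equal values across all networks of the same size, since a node
    cannot tell which of them it is in. *)
Definition determined (a : nat) (T : nat -> nat) (I O : Type)
    (F : forall G : sgraph, (G -> nat) -> (G -> I) -> G -> O) : Prop :=
  forall (G G' : sgraph) (id : G -> nat) (id' : G' -> nat) (x : G -> I) (x' : G' -> I) u u',
    valid_ids a id -> valid_ids a id' -> #|G| = #|G'| ->
    knowledge id x (T #|G|) u = knowledge id' x' (T #|G|) u' ->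
    F G id x u = F G' id' x' u'.

(** It suffices to gather for [T] rounds and to read off the value of [F] in any network that
    produces the gathered tree; all such networks give the same value. *)
Lemma determined_local a T (I O : Type)
    (F : forall G : sgraph, (G -> nat) -> (G -> I) -> G -> O) :
  O -> determined a T F ->
  exists A : local_alg I O, forall (G : sgraph) (id : G -> nat) (x : G -> I),
    valid_ids a id -> forall u, lout (local_run A id x (T #|G|) u) = F G id x u.
Proof.
move=> o0 Fdet.
pose witness (s : knowledge_tree I) (o : O) :=
  exists (G : sgraph) (id : G -> nat) (x : G -> I) (u : G),
  [/\ valid_ids a id, s = knowledge id x (T #|G|) u & o = F G id x u].
(* [o0] is the output on trees that arise in no network with valid identifiers. *)
exists (gather (fun s =>
  if pselect (exists o, witness s o) is left h then sval (cid h) else o0)).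
move=> G id x vid u; 
change ((if pselect (exists o, witness (knowledge id x (T #|G|) u) o) is left h
  then sval (cid h) else o0) = F G id x u).
case: pselect => [h|[]]; last by exists (F G id x u), G, id, x, u.
case: (cid h) => _ /= [G' [id' [x' [u' [vid' kn ->]]]]].
have [c e] := knowledge_root id x (T #|G|) u.
have [c' e'] := knowledge_root id' x' (T #|G'|) u'.
have eG : #|G| = #|G'| by move: kn; rewrite e e' => -[].
by apply/esym/Fdet => //; rewrite kn eG.
Qed.

(** * Power graphs *)

Section Power.
Variables (r : nat) (G : sgraph).

Definition power_adj : rel G := fun u v => (u != v) && Defs.within r u v.

Lemma power_adj_sym : symmetric power_adj.
Proof.
move=> u v; rewrite /power_adj eq_sym; congr andb.
by apply/withinP/withinP; exact: (reach_sym (@adj_sym G)).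
Qed.

Lemma power_adj_irr : irreflexive power_adj.
Proof. by move=> u; rewrite /power_adj eqxx. Qed.

Definition power : sgraph := SGraph power_adj_sym power_adj_irr.

Lemma reach_power k (u v : G) :
  reach (@adj power) k u v -> reach (@adj G) (k * r) u v.
Proof.
move=> [p [+ <- +]]; elim: p k u => [|z p IH] k u /=; first by move=> *; exact: reach_refl.
case: k => // k /andP[/andP[_ /withinP uz] zp] sp.
by rewrite mulSn; apply: reach_trans uz _; exact: IH.
Qed.

End Power.

(** A round on the power graph is paid for with [r] levels of knowledge, as its neighbors lie within
    distance [r]. That two nodes are distinct can be read off their identifiers. *)
Lemma determined_power (I O : Type) (A : local_alg unit O) r s (G G' : sgraph)
    (id : G -> nat) (id' : G' -> nat) (x : G -> I) (x' : G' -> I) u u' :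
  injective id -> injective id' ->
  knowledge id x (r * s) u = knowledge id' x' (r * s) u' ->
  @local_run _ _ A (power r G) id (fun=> tt) s u =
  @local_run _ _ A (power r G') id' (fun=> tt) s u'.
Proof.
move=> inj inj'; elim: s u u' => [|s IH] u u' kn.
  by have [nn ii _] := knowledge_eq_root kn; rewrite /local_run /= nn ii.
rewrite {1 2}/local_run !iterS /local_round.
rewrite -/(@local_run _ _ A (power r G) id (fun=> tt) s).
rewrite -/(@local_run _ _ A (power r G') id' (fun=> tt) s).
have [_ ii _] := knowledge_eq_root kn.
congr lrecv; first by apply: IH; apply: knowledge_eq_leq kn; rewrite leq_mul.
apply/funext => j; rewrite mulnSr in kn.
apply: eq_omap_pick => // [w /andP[uw /withinP rw] idw|w' /andP[uw /withinP rw] idw].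
  have [w' rw' knw] := knowledge_eq_reach inj kn rw.
  have [_ iw _] := knowledge_eq_root knw.
  exists w'; split; [|by rewrite -iw|by rewrite (IH _ _ knw) ii].
  apply/andP; split; last exact/withinP.
  by apply: contra uw => /eqP e; apply/eqP/inj; rewrite ii iw e.
have [w rw' knw] := knowledge_eq_reach inj' (esym kn) rw.
have [_ iw _] := knowledge_eq_root knw.
exists w; last by rewrite -iw.
apply/andP; split; last exact/withinP.
by apply: contra uw => /eqP e; apply/eqP/inj'; rewrite -ii iw e.
Qed.

(** * SLOCAL runs in increasing label order *)

Section SlocalRun.
Context {I O : Type} (A : slocal_alg I O) {G : sgraph}.
Context (id : G -> nat) (x : G -> I) (r : nat).

Local Notation run := (slocal_run A id x r).

Lemma foldl_slocal_step_notin o m w :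
  w \notin o -> foldl (slocal_step (A:=A) id x r) m o w = m w.
Proof.
elim: o m => [//|v o IH] m /=; rewrite inE negb_or => /andP[wv wo].
by rewrite IH // /slocal_step (negbTE wv).
Qed.

Lemma slocal_run_rcons o v w : run (rcons o v) w =
  if w == v then Some (sstep #|G| (view_of id x r (run o) v)) else run o w.
Proof. by rewrite /slocal_run foldl_rcons. Qed.

(** The nodes processed before [v] are those of smaller label, and their entries are never
    rewritten. So the final values of the run satisfy a recursion along the labels. *)
Lemma slocal_run_sorted (lab : G -> nat) o v :
  uniq o -> sorted ltn (map lab o) -> (forall w, w \in o) ->
  run o v = Some (sstep #|G| (view_of id x r
    (fun w => if (lab w < lab v)%N then run o w else None) v)).
Proof.
move=> o_uniq o_sorted all_o.
case/path.splitPr: (all_o v) (all_o) o_uniq o_sorted => o1 o2 {}all_o.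
rewrite cat_uniq => /and3P[_ /= dis /andP[vo2 _]].
rewrite (sorted_pairwise ltn_trans) map_cat pairwise_cat /=.
move=> /andP[/allrelP lt12 /and3P[_ /allP ltv2 _]].
have nv1 : v \notin o1 by apply: contra dis => ->.
have -> : run (o1 ++ v :: o2) v = Some (sstep #|G| (view_of id x r (run o1) v)).
  by rewrite /slocal_run foldl_cat /= foldl_slocal_step_notin // /slocal_step eqxx.
congr (Some (sstep _ (view_of _ _ _ _ _))); apply/funext => w.
case: (boolP (w \in o1)) => wo1.
  rewrite lt12 ?map_f ?mem_head //.
  rewrite [RHS]/slocal_run foldl_cat foldl_slocal_step_notin //.
  apply: contra dis => /[dup] wo2; rewrite inE => /orP[/eqP e|wo2'].
    by move: nv1; rewrite -e wo1.
  by apply/orP; right; apply/hasP; exists w.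
have : run o1 w = None by rewrite /slocal_run foldl_slocal_step_notin.
move=> ->; case: ifP => // lwv; have := all_o w; rewrite mem_cat (negbTE wo1) inE /=.
case/orP => [/eqP e|wo2]; first by move: lwv; rewrite e ltnn.
by have := ltv2 (lab w) (map_f _ wo2); rewrite ltnNge ltnW.
Qed.

End SlocalRun.

(** Read backwards, a descending path is increasing, so the ordering bounds the distance between its
    ends. *)
Lemma descending_reach (R : realType) (D : R) (G : sgraph) (lab : G -> nat) u p :
  diameter_ordering D lab ->
  path (fun y z : G => adj y z && (lab z < lab y)%N) u p ->
  reach (@adj G) (Num.truncn D) u (last u p).
Proof.
move=> [_ diam] up.
have : path [rel y z : G | adj y z && relpre lab ltn y z] (last u p) (rev (belast u p)).
  rewrite rev_path; apply: sub_path up => y z /= /andP[yz ->].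
  by rewrite adj_sym yz.
rewrite path_relI => /andP[adj_p lt_p].
have memE y : (y \in last u p :: rev (belast u p)) = (y \in u :: p).
  by rewrite -rev_rcons -lastI mem_rev.
have lt_sorted : sorted ltn (map lab (last u p :: rev (belast u p))) by rewrite /= path_map.
have [|| k kD /withinP] := diam _ _ adj_p lt_sorted u (last u p).
- by rewrite memE mem_head.
- by rewrite memE mem_last.
by apply: reach_leq; rewrite truncn_ge_nat //; apply: le_trans kD; rewrite ler0n.
Qed.

(** The ends of a view edge lie within distance [r]; one further level shows that they are adjacent.
    The converse inclusion follows by exchanging the graphs. *)
Lemma ball_edge_sub (I : Type) (G G' : sgraph) (id : G -> nat) (id' : G' -> nat)
    (x : G -> I) (x' : G' -> I) k r (w : G) (w' : G') i j :
  injective id -> injective id' ->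
  knowledge id x (k.+1 + r) w = knowledge id' x' (k.+1 + r) w' ->
  [exists u : G, exists v : G,
     [&& Defs.within r w u, Defs.within r w v, adj u v, id u == i & id v == j]] ->
  [exists u : G', exists v : G',
     [&& Defs.within r w' u, Defs.within r w' v, adj u v, id' u == i & id' v == j]].
Proof.
move=> inj inj' kn /existsP[u /existsP[v /and5P[/withinP wu /withinP wv uv /eqP <- /eqP <-]]].
have [u' wu' knu] := knowledge_eq_reach inj kn wu.
have [v' wv' knv] := knowledge_eq_reach inj kn wv.
have [_ iu _] := knowledge_eq_root knu.
have [_ iv _] := knowledge_eq_root knv.
have [v'' uv'' knv''] := knowledge_eq_adj inj knu uv.
have [_ iv'' _] := knowledge_eq_root knv''.
have e : v'' = v' by apply: inj'; rewrite -iv -iv''.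
apply/existsP; exists u'; apply/existsP; exists v'.
rewrite iu iv !eqxx -e uv'' e /= andbT; apply/andP; split; exact/withinP.
Qed.

(** * Running an SLOCAL algorithm along the labels of the power graph *)

Section Simulation.
Variables (I O : Type) (A : local_alg unit nat) (B : slocal_alg I O) (r t : nat).

Definition power_label (G : sgraph) (id : G -> nat) : G -> nat :=
  fun v => lout (@local_run _ _ A (power r G) id (fun=> tt) t v).

Definition label_order (G : sgraph) (id : G -> nat) : seq G :=
  sort (relpre (power_label id) leq) (enum G).

Definition label_run (G : sgraph) (id : G -> nat) (x : G -> I) : G -> option (O * smem B) :=
  slocal_run B id x r (label_order id).

Lemma label_runE (G : sgraph) (id : G -> nat) (x : G -> I) v :
  injective (power_label id) ->
  label_run id x v = Some (sstep #|G| (view_of id x r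
    (fun w => if (power_label id w < power_label id v)%N then label_run id x w else None) v)).
Proof.
move=> inj; apply: slocal_run_sorted.
- by rewrite sort_uniq enum_uniq.
- rewrite ltn_sorted_uniq_leq map_inj_uniq // sort_uniq enum_uniq /=.
  rewrite sorted_map; apply: sort_sorted => u w; exact: leq_total.
- by move=> w; rewrite mem_sort mem_enum.
Qed.

Variables (R : realType) (D : R) (G G' : sgraph) (id : G -> nat) (id' : G' -> nat).
Variables (x : G -> I) (x' : G' -> I).
Hypotheses (id_inj : injective id) (id_inj' : injective id').
Hypothesis lab_diam : @diameter_ordering R D (power r G) (power_label id).
Hypothesis lab_diam' : @diameter_ordering R D (power r G') (power_label id').

Local Notation radius := (Num.truncn D).

Lemma power_label_knowledge u u' :
  knowledge id x (r * t).+1 u = knowledge id' x' (r * t).+1 u' ->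
  power_label id u = power_label id' u'.
Proof.
move=> kn; rewrite /power_label; congr lout.
by apply: (@determined_power _ _ A r t _ _ id id' x x') => //; exact: knowledge_eq_pred.
Qed.

(** The depth consists of [(r * t).+1] levels for labels and edges, [r] for the view and
    [radius * r] for the dependencies. Plain recursion would lose [r] levels per dependency. Instead
    each dependency is compared from [u] itself, from which it is reached by a label-descending path
    of the power graph. *)
Lemma label_run_knowledge u u' :
  knowledge id x ((r * t).+1 + r + radius * r) u =
  knowledge id' x' ((r * t).+1 + r + radius * r) u' ->
  label_run id x u = label_run id' x' u'.
Proof.
move=> kn.
pose descends w := exists2 p, path (fun y z : power r G =>
  adj y z && (power_label id z < power_label id y)%N) u p & last u p = w.
have desc_near w : descends w -> exists2 w',
    knowledge id x ((r * t).+1 + r) w = knowledge id' x' ((r * t).+1 + r) w' & id w = id' w'.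
  move=> [p up <-].
  have := reach_power (descending_reach lab_diam up).
  case/(knowledge_eq_reach id_inj kn) => w' _ kw.
  by exists w' => //; have [] := knowledge_eq_root kw.
(* Induction on a bound for the label: dependencies have smaller labels and still descend from
   [u]. *)
suff main N w w' : (power_label id w < N)%N -> descends w ->
    knowledge id x ((r * t).+1 + r) w = knowledge id' x' ((r * t).+1 + r) w' ->
    label_run id x w = label_run id' x' w'.
  apply: (main (power_label id u).+1) => //; first by exists [::].
  by apply: knowledge_eq_leq kn; rewrite leq_addr.
elim: N w w' => [//|N IH] w w' wN desc_w kw.
have [eG iw _] := knowledge_eq_root kw.
have lw : power_label id w = power_label id' w'.
  by apply: power_label_knowledge; apply: knowledge_eq_leq kw; rewrite leq_addr.
rewrite !label_runE; [|exact: lab_diam'.1|exact: lab_diam.1].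
rewrite -eG; congr (Some (sstep _ _)); rewrite /view_of iw; congr View; last first.
  apply/funext => i; apply/funext => j; apply/idP/idP.
    exact: (ball_edge_sub id_inj id_inj' kw).
  exact: (ball_edge_sub id_inj' id_inj (esym kw)).
apply/funext => j; apply: eq_omap_pick => // [z /withinP wz idz|z' /withinP wz idz]; last first.
  have [z rz kz] := knowledge_eq_reach id_inj' (esym kw) wz.
  exists z; first exact/withinP.
  by have [_ <- _] := knowledge_eq_root kz.
have [z' rz kz] := knowledge_eq_reach id_inj kw wz.
have [_ iz xz] := knowledge_eq_root kz.
exists z'; split; [exact/withinP|by rewrite -iz|rewrite xz; congr pair].
rewrite -lw -(power_label_knowledge kz); case: ifP => // lzw.
have desc_z : descends z.
  have [p up pw] := desc_w; exists (rcons p z); last by rewrite last_rcons.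
  rewrite rcons_path up pw lzw andbT /= /power_adj; apply/andP; split; last exact/withinP.
  by apply: contraL lzw => /eqP ->; rewrite ltnn.
(* The knowledge inherited from [w] is too shallow to recurse on. The one obtained from [u] has full
   depth and concerns the same node, as the identifiers agree. *)
have [z'' kz'' iz''] := desc_near z desc_z.
have -> : z' = z'' by apply: id_inj'; rewrite -iz -iz''.
by apply: IH => //; apply: leq_trans lzw _; rewrite -ltnS.
Qed.

End Simulation.

(** The power graph has the nodes and identifiers of [G], so the ordering algorithm applies to it.
    The simulated outputs depend on bounded knowledge only, and are valid because the SLOCAL
    algorithm is correct for the label order. *)
Lemma ordering_local_hard (R : realType) a t (d : nat -> R) (r : nat -> nat) (Q : problem) :
  LOCAL a t (diameter_ordering_problem d) -> SLOCAL a r Q ->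
  LOCAL a (fun n => (r n * t n).+1 + r n + Num.truncn (d n) * r n)%N Q.
Proof.
move=> [A HA] [B HB].
(* A step on an empty view exhibits an inhabitant of the output type. *)
pose o0 := (@sstep _ _ B 0 (View 0 (fun=> None) (fun _ _ => false))).1.
pose F (G : sgraph) (id : G -> nat) (x : G -> input Q) u :=
  odflt o0 (omap fst (label_run A B (r #|G|) (t #|G|) id x u)).
have diam (G : sgraph) (id : G -> nat) : valid_ids a id ->
    @diameter_ordering R (d #|G|) (power (r #|G|) G) (power_label A (r #|G|) (t #|G|) id).
  exact: (HA (power (r #|G|) G) id (fun=> tt)).
have Fdet : determined a (fun n => (r n * t n).+1 + r n + Num.truncn (d n) * r n)%N F.
  move=> G G' id id' x x' u u' vid vid' eG kn; rewrite /F.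
  have := diam G' id' vid'; rewrite -!eG => diam'.
  by rewrite (label_run_knowledge B vid.1 vid'.1 (diam G id vid) diam' kn).
have [A' HA'] := determined_local o0 Fdet; exists A' => G id x vid.
set run := (fun v => _); have -> : run = F G id x.
  by apply/funext => v; exact: HA'.
have [|y [yrun yvalid]] := HB G id x (label_order A (r #|G|) (t #|G|) id) vid.
  by rewrite perm_sort.
by have -> : F G id x = y by apply/funext => v; rewrite /F /label_run yrun.
Qed.

(** * Sequential ball carving *)

Local Open Scope nat_scope.

Record carving := Carving { level : nat; cluster : seq nat; boundary : seq nat }.

(* The state of a node is [i.*2] while it is unclustered at level i, and
   [i.*2.+1] once it belongs to a cluster of color i. *)
Definition carve (s : nat -> nat) (c : carving) : nat -> nat := fun w =>
  if w \in cluster c then (level c).*2.+1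
  else if w \in boundary c then (level c).*2.+2 else s w.

(** Distances to the center are taken in all of [E], so only the weak diameter of a cluster is
    bounded. By the last condition, unclustered nodes that border the cluster end up at a level
    above its color. *)
Definition carvable (E : rel nat) (L : nat) (s : nat -> nat) (c : carving) : Prop :=
  [/\ forall w, w \in cluster c ++ boundary c -> s w = (level c).*2,
      uniq (cluster c ++ boundary c),
      size (boundary c) <= size (cluster c),
      exists u, forall w, w \in cluster c -> reach E L u w
    & forall w z, w \in cluster c -> E w z -> ~~ odd (s z) ->
        z \in cluster c ++ boundary c \/ (level c).*2 < s z].

Definition carving_near (E : rel nat) (r v : nat) (c : carving) : Prop :=
  (forall w, w \in cluster c -> reach E r v w) /\
  (forall w, w \in boundary c -> reach E r.+1 v w).

Fixpoint carvable_seq (E : rel nat) (L r v : nat) (s : nat -> nat)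
    (cs : seq carving) : Prop :=
  if cs is c :: cs' then
    [/\ carvable E L s c, carving_near E r v c & carvable_seq E L r v (carve s c) cs']
  else True.

Lemma count_lt (T : eqType) (P Q : pred T) (S : seq T) w :
  subpred P Q -> w \in S -> Q w -> ~~ P w -> count P S < count Q S.
Proof.
move=> PQ wS Qw Pw; have := count_predUI P (pred1 w) S.
have -> : count (predI P (pred1 w)) S = 0.
  apply/eqP; rewrite -leqn0 leqNgt -has_count; apply/hasPn => z _ /=.
  by case: eqP => [->|_]; rewrite ?andbF // (negbTE Pw).
have : 0 < count_mem w S by rewrite -has_count has_pred1.
have : count (predU P (pred1 w)) S <= count Q S.
  by apply: sub_count => z /= /orP[/PQ//|/eqP ->].
lia.
Qed.

Lemma count_mem_leq_size (T : eqType) (S C : seq T) :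
  uniq S -> count (mem C) S <= size C.
Proof.
move=> uS; rewrite -size_filter; apply: uniq_leq_size; first exact: filter_uniq.
by move=> z; rewrite mem_filter => /andP[].
Qed.

Lemma size_leq_count_mem (T : eqType) (S C : seq T) :
  uniq C -> {subset C <= S} -> size C <= count (mem C) S.
Proof.
move=> uC CS; rewrite -size_filter; apply: uniq_leq_size => // z zC.
by rewrite mem_filter /= zC CS.
Qed.

(** * Existence of carvings by ball growing *)

Section CarvingExists.
Variables (S : seq nat) (E : rel nat) (L : nat).
Hypotheses (S_uniq : uniq S) (E_S : forall j k, E j k -> k \in S).
Hypothesis S_size : size S < 2 ^ L.+1.

Section Grow.
Variables (s : nat -> nat) (i u : nat).
Hypotheses (uS : u \in S) (su : s u = i.*2).

Definition grow (r : nat) : seq nat := iter r (fun B =>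
  [seq z <- S | (z \in B) || ((s z == i.*2) && has (E^~ z) B)]) [:: u].

Lemma growS r z : (z \in grow r.+1) =
  (z \in S) && ((z \in grow r) || ((s z == i.*2) && has (E^~ z) (grow r))).
Proof. by rewrite /= mem_filter andbC. Qed.

Lemma grow_uniq r : uniq (grow r).
Proof. by case: r => [//|r]; exact: filter_uniq. Qed.

Lemma grow_sub r : {subset grow r <= S}.
Proof. by case: r => [|r] z; [rewrite inE => /eqP ->|rewrite growS => /andP[]]. Qed.

Lemma growW r : {subset grow r <= grow r.+1}.
Proof. by move=> z zr; rewrite growS zr (grow_sub zr). Qed.

Lemma mem_grow r : u \in grow r.
Proof. by elim: r => [|r /growW//]; rewrite mem_head. Qed.

Lemma grow_level r z : z \in grow r -> s z = i.*2.
Proof.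
elim: r => [|r IH]; first by rewrite inE => /eqP ->.
by rewrite growS => /andP[_ /orP[/IH//|/andP[/eqP]]].
Qed.

Lemma grow_reach r z : z \in grow r -> reach E r u z.
Proof.
elim: r z => [|r IH] z; first by rewrite inE => /eqP ->; exact: reach_refl.
rewrite growS => /andP[_ /orP[/IH|/andP[_ /hasP[w /IH uw wz]]]].
  by apply: reach_leq.
by rewrite -addn1; apply: reach_trans uw (reach1 wz).
Qed.

(** If each of the first [L.+1] steps more than doubled the ball, it would reach [2 ^ L.+1] names,
    more than [S] contains. *)
Lemma grow_slow : exists2 r, r <= L & size (grow r.+1) <= (size (grow r)).*2.
Proof.
suff /hasP[r] : has (fun r => size (grow r.+1) <= (size (grow r)).*2) (iota 0 L.+1).
  by rewrite mem_iota add0n ltnS => ? ?; exists r.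
apply: contraT => /hasPn fast.
have : 2 ^ L.+1 <= size (grow L.+1).
  have : L.+1 <= L.+1 by [].
  (* The induction shows [2 ^ r <= size (grow r)] for [r <= L.+1], keeping the upper bound [L.+1]
     fixed. *)
  elim: {1 3 4}L.+1 => [//|r IH] rL.
  have := fast r; rewrite mem_iota add0n rL => /(_ isT); rewrite -ltnNge.
  by have := IH (ltnW rL); rewrite expnS mul2n -leq_double => /leq_ltn_trans/[apply]/ltnW.
by rewrite leqNgt (leq_ltn_trans _ S_size) // uniq_leq_size ?grow_uniq //; exact: grow_sub.
Qed.

(** The cluster is the ball just before a slow step, and the boundary is what that step adds: at
    most as much as was there. *)
Lemma ball_carving : exists C D : seq nat,
  [/\ forall w, w \in C ++ D -> s w = i.*2, uniq (C ++ D), size D <= size C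
    & [/\ u \in C, forall w, w \in C -> reach E L u w,
      forall w, w \in D -> reach E L.+1 u w
    & forall w z, w \in C -> E w z -> s z = i.*2 -> z \in C ++ D]].
Proof.
have [r rL slow] := grow_slow.
pose D := [seq z <- grow r.+1 | z \notin grow r].
exists (grow r), D; split; [| | |split].
- move=> w; rewrite mem_cat mem_filter => /orP[/grow_level//|/andP[_]].
  exact: grow_level.
- rewrite cat_uniq grow_uniq filter_uniq ?grow_uniq // andbT.
  by apply/hasPn => z; rewrite mem_filter => /andP[].
- have : count (mem (grow r)) (grow r.+1) + size D = size (grow r.+1).
    by rewrite size_filter; exact: count_predC.
  move=> sizeD; rewrite -(leq_add2l (size (grow r))) addnn.
  apply: leq_trans slow; rewrite -sizeD leq_add2r.
  exact: size_leq_count_mem (grow_uniq r) (@growW r).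
- exact: mem_grow.
- by move=> w /grow_reach; exact: reach_leq.
- move=> w; rewrite mem_filter => /andP[_ /grow_reach]; exact: reach_leq.
- move=> w z wC wz /eqP sz; rewrite mem_cat mem_filter.
  case: (boolP (z \in grow r)) => //= _; rewrite -/(grow r.+1) growS (E_S wz) sz /=.
  by apply/orP; right; apply/hasP; exists w.
Qed.

End Grow.

(* If the cluster around v touches an unclustered node of lower level, that node
   has to be treated first; as levels decrease, this stops after i steps. *)
Lemma carvable_exists s v i : v \in S -> s v = i.*2 ->
  exists c, [/\ carvable E L s c, carving_near E (i * L.+1 + L) v c
              & exists2 w, w \in cluster c & w \in S].
Proof.
elim/ltn_ind: i v => i IH v vS sv.
have [C [D [sCD uCD sizeD [vC Cnear Dnear CDclosed]]]] := ball_carving vS sv.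
case: (boolP (has (fun z => [&& has (E^~ z) C, ~~ odd (s z) & s z < i.*2]) S)).
  move=> /hasP[z zS /and3P[/hasP[w wC wz] ez szi]].
  have sz : s z = (s z)./2.*2 by rewrite even_halfK.
  have lt_i : (s z)./2 < i by rewrite -ltn_double -sz.
  have [c [car [near near'] ne]] := IH _ lt_i z zS sz.
  exists c; split=> //.
  have vz : reach E L.+1 v z.
    by rewrite -addn1; apply: reach_trans (Cnear _ wC) (reach1 wz).
  (* Passing to a lower level costs at most [L] steps inside the cluster and one more to leave
     it. *)
  have le : L.+1 + ((s z)./2 * L.+1 + L) <= i * L.+1 + L.
    by rewrite addnA -mulSn leq_add2r leq_mul2r lt_i orbT.
  split=> y /[dup] yc; [move/near|move/near'] => zy.
    exact: reach_leq le (reach_trans vz zy).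
  by apply: reach_leq (reach_trans vz zy); rewrite addnS ltnS.
move=> /hasPn low; exists (Carving i C D); split; last by exists v.
  split=> //=; first by exists v.
  move=> w z wC wz ez; have := low z (E_S wz).
  have -> : has (E^~ z) C by apply/hasP; exists w.
  rewrite ez /= -leqNgt leq_eqVlt => /orP[/eqP e|]; last by right.
  by left; apply: CDclosed wC wz _.
split=> w /=; first by move/Cnear; apply: reach_leq; rewrite leq_addl.
by move/Dnear; apply: reach_leq; rewrite ltnS leq_addl.
Qed.

(** Carving is repeated until [v] is clustered or above level [L]; it stops because each carving
    clusters a new name of [S]. The second outcome is excluded later, by the halving of levels. *)
Lemma carvable_seq_exists s v : v \in S -> exists2 cs,
  carvable_seq E L (L * L.+1 + L) v s cs
  & odd (foldl carve s cs v) || (L.*2 < foldl carve s cs v).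
Proof.
move=> vS; have [m] := ubnP (count (fun w => ~~ odd (s w)) S).
elim: m s => [//|m IH] s; rewrite ltnS => sm.
case: (boolP (odd (s v) || (L.*2 < s v))) => [done|]; first by exists [::].
rewrite negb_or -leqNgt => /andP[ev sL].
have sv : s v = (s v)./2.*2 by rewrite even_halfK.
have [c [car [near near'] [w wC wS]]] := carvable_exists vS sv.
have lt_m : count (fun z => ~~ odd (carve s c z)) S < m.
  apply: leq_trans sm; have [lev _ _ _ _] := car.
  apply: (count_lt (w := w)) => //; last by rewrite /carve wC /= odd_double.
    move=> z; rewrite /carve; case: ifP => [_|_]; first by rewrite /= odd_double.
    case: ifP => // zD _; by rewrite lev ?odd_double // mem_cat zD orbT.
  by rewrite lev ?odd_double // mem_cat wC.
have [cs cs_ok fin] := IH _ lt_m; exists (c :: cs) => //=; split=> //.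
have le : (s v)./2 * L.+1 + L <= L * L.+1 + L.
  by rewrite leq_add2r leq_mul2r -leq_double -sv sL orbT.
by split=> y; [move/near|move/near']; apply: reach_leq.
Qed.

End CarvingExists.

(** * Halving of levels and separation of clusters *)

Section CarvingInvariant.
Variables (S : seq nat) (E : rel nat) (L : nat).
(* The first part bounds the levels by log2 (size S): at least half of the nodes
   that reach level i are clustered with color i. *)
Definition carving_inv (s : nat -> nat) : Prop :=
  [/\ forall i, count (fun w => i.*2.+1 < s w) S <= count (fun w => s w == i.*2.+1) S,
      forall w z, E w z -> odd (s w) -> ~~ odd (s z) -> s w < s z
    & exists center : nat -> nat,
        (forall w, odd (s w) -> reach E L (center w) w) /\
        (forall w z, E w z -> odd (s w) -> s w = s z -> center w = center z)].

Lemma carving_inv0 : carving_inv (fun=> 0).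
Proof.
split; first by move=> i; rewrite (eq_count (a2 := pred0)) ?count_pred0.
  by [].
by exists idfun; split.
Qed.

(** Among the names of state at least [i.*2], those beyond [i.*2.+1] are no more than those equal to
    [i.*2.+1]; hence each level keeps at most half of the previous one. *)
Lemma carving_inv_level s w i :
  carving_inv s -> w \in S -> i.*2 <= s w -> 2 ^ i <= size S.
Proof.
move=> [half _ _] wS; have : count (fun z => i.*2 <= s z) S * 2 ^ i <= size S.
  elim: i => [|i IH]; first by rewrite muln1 count_size.
  apply: leq_trans IH; rewrite expnS mulnA leq_mul2r; apply/orP; right.
  have := count_predUI (fun z => i.*2.+1 < s z) (fun z => s z == i.*2.+1) S.
  rewrite (_ : count (predI _ _) S = 0); last first.
    by apply/eqP; rewrite -leqn0 leqNgt -has_count; apply/hasPn => z _ /=; lia.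
  have : count (predU (fun z => i.*2.+1 < s z) (fun z => s z == i.*2.+1)) S
      <= count (fun z => i.*2 <= s z) S by apply: sub_count => z /=; lia.
  have := half i; rewrite doubleS; lia.
move=> le sw; apply: leq_trans le; rewrite leq_pmull // -has_count.
by apply/hasP; exists w.
Qed.

Hypothesis E_sym : symmetric E.

(* Along the path the colors do not decrease, and nodes of the same color share
   their cluster, so that at most one cluster per color is crossed. *)
Lemma carving_path s N u p :
  carving_inv s -> path E u p -> (forall w, w \in u :: p -> odd (s w) /\ w < N) ->
  sorted ltn (map (fun w => (s w)./2 * N + w) (u :: p)) ->
  let w := last u p in
  (s u)./2 <= (s w)./2 /\
  reach E (L + ((L.*2.+1) * ((s w)./2 - (s u)./2) + L)) u w.
Proof.
move=> [_ _ [ctr [ctr_near ctr_eq]]] + + + w.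
have near_u v : odd (s v) -> reach E L v (ctr v).
  by move=> ov; apply: reach_sym => //; exact: ctr_near.
(* Distances are measured from the center of [u], so that the induction goes from center to
   center. *)
suff main : path E u p -> (forall w, w \in u :: p -> odd (s w) /\ w < N) ->
    sorted ltn (map (fun w => (s w)./2 * N + w) (u :: p)) ->
    (s u)./2 <= (s w)./2 /\ reach E (L.*2.+1 * ((s w)./2 - (s u)./2) + L) (ctr u) w.
  move=> up ok lt; have [le re] := main up ok lt; split=> //.
  by apply: reach_trans re; apply: near_u; have [] := ok u (mem_head _ _).
rewrite {}/w; elim: p u => [|z p IH] u /=.
  move=> _ ok _; split=> //; have [ou _] := ok u (mem_head _ _).
  by apply: reach_leq (ctr_near u ou); rewrite leq_addl.
move=> /andP[uz zp] ok /andP[lt_uz lt_p].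
have [ou uN] := ok u (mem_head _ _).
have [|le re] := IH z zp _ lt_p; first by move=> y yp; apply: ok; rewrite inE yp orbT.
have [oz zN] : odd (s z) /\ z < N by apply: ok; rewrite !inE eqxx orbT.
(* As [z] is below [N], a drop in color would outweigh the identifiers and decrease the label. *)
have le_uz : (s u)./2 <= (s z)./2.
  rewrite leqNgt; apply/negP => lt.
  have : (s z)./2.+1 * N <= (s u)./2 * N by rewrite leq_mul2r lt orbT.
  by rewrite mulSn; lia.
split; first exact: leq_trans le.
move: le_uz; rewrite leq_eqVlt => /orP[/eqP e|lt].
  have sE : s u = s z by rewrite -(odd_double_half (s u)) -(odd_double_half (s z)) ou oz e.
  by rewrite (ctr_eq u z uz ou sE) e.
(* Changing clusters costs [L] from the old center, one edge, and [L] to the new center. *)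
have step : reach E (L.*2.+1) (ctr u) (ctr z).
  have -> : L.*2.+1 = L + (1 + L) by lia.
  apply: reach_trans (ctr_near u ou) _; apply: reach_trans (reach1 uz) (near_u z oz).
apply: reach_leq (reach_trans step re).
rewrite addnA leq_add2r -mulnS leq_mul2l; apply/orP; right; lia.
Qed.

Hypothesis S_uniq : uniq S.

(** The counts change for the carved color only: one side gains the cluster, the other at most as
    many boundary names. *)
Lemma carving_inv_carve s c : {subset cluster c ++ boundary c <= S} ->
  carvable E L s c -> carving_inv s -> carving_inv (carve s c).
Proof.
case: c => l C D /= CDS [/= lev uCD sizeD [u Cu] closed] [half sep [ctr [ctr_near ctr_eq]]].
have levC w : w \in C -> s w = l.*2 by move=> wC; rewrite lev // mem_cat wC.
have levD w : w \in D -> s w = l.*2 by move=> wD; rewrite lev // mem_cat wD orbT.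
have [uC dis uD] : [/\ uniq C, ~~ has (mem C) D & uniq D].
  by apply/and3P; rewrite -cat_uniq.
have CS : {subset C <= S} by move=> w wC; rewrite CDS // mem_cat wC.
split.
- move=> i; have [->|il] := eqVneq i l.
    apply: (@leq_trans (count (fun w => l.*2.+1 < s w) S + count (mem D) S)).
      rewrite -count_predUI; apply: leq_trans (leq_addr _ _); apply: sub_count => w /=.
      rewrite /carve /=; case: ifP => _; first by rewrite ltnn.
      by case: ifP => [wD _|_ -> //]; apply/orP; right.
    apply: (@leq_trans (count (fun w => s w == l.*2.+1) S + count (mem C) S)).
      apply: leq_add => //; apply: leq_trans (count_mem_leq_size _ S_uniq) _.
      exact: leq_trans sizeD (size_leq_count_mem uC CS).
    rewrite -count_predUI (_ : count (predI _ _) S = 0) ?addn0.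
      apply: sub_count => w /= /orP[/eqP sw|wC].
        rewrite /carve /=; case: ifP => [/levC|_]; first by lia.
        by case: ifP => [/levD|_]; [lia|rewrite sw].
      by rewrite /carve /= (wC : w \in C).
    apply/eqP; rewrite -leqn0 leqNgt -has_count; apply/hasPn => w _ /=.
    by apply/negP => /andP[/eqP sw /levC]; lia.
  rewrite (eq_count (a2 := fun w => i.*2.+1 < s w)); last first.
    move=> w; rewrite /carve /=; case: ifP => [/levC ->|_]; first by lia.
    by case: ifP => [/levD ->|//]; lia.
  rewrite [X in _ <= X](eq_count (a2 := fun w => s w == i.*2.+1)) //.
  move=> w; rewrite /carve /=; case: ifP => [/levC ->|_]; first by lia.
  by case: ifP => [/levD ->|//]; lia.
- move=> w z wz; rewrite /carve /=; case: ifP => [wC _|wC].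
    case: ifP => zC; first by rewrite /= odd_double.
    case: ifP => zD ez; first by lia.
    have [|lz] := closed w z wC wz ez; first by rewrite mem_cat zC zD.
    by lia.
  case: ifP => wD; first by rewrite /= odd_double.
  move=> ow; case: ifP => zC; first by rewrite /= odd_double.
  case: ifP => zD ez; last exact: sep.
  have := sep w z wz ow; rewrite (levD z zD) odd_double => /(_ isT); lia.
- exists (fun w => if w \in C then u else ctr w); split.
    move=> w; rewrite /carve /=; case: ifP => [/Cu//|_].
    case: ifP => [_|_ /ctr_near//]; by rewrite /= odd_double.
  (* A neighbor that already had color [l] would have bordered an unclustered name of level [l],
     against the earlier separation. *)
  have clash w z : E w z -> w \in C -> (z \in C) = false ->
      carve s (Carving l C D) z = l.*2.+1 -> False.
    move=> wz wC zC; rewrite /carve /= zC; case: ifP => [_|_ sz]; first by lia.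
    have := sep z w; rewrite E_sym wz sz (levC w wC) /= odd_double => /(_ isT isT isT); lia.
  move=> w z wz; case: ifP => wC; case: ifP => zC //.
  + move=> _ sw; case: (clash w z wz wC zC).
    by rewrite -sw /carve /= wC.
  + move=> _ sw; rewrite E_sym in wz; case: (clash z w wz zC wC).
    by rewrite sw /carve /= zC.
  + rewrite /carve /= wC zC; case: ifP => wD; first by rewrite /= odd_double.
    case: ifP => zD; last exact: ctr_eq.
    move=> ow sw; move: ow; by rewrite sw /= odd_double.
Qed.

End CarvingInvariant.

(** * Effect and locality of carving sequences *)

Section CarvableSeq.
Variables (E : rel nat) (L r v : nat).

Lemma carve_seq_odd s cs w :
  carvable_seq E L r v s cs -> odd (s w) -> foldl carve s cs w = s w.
Proof.
elim: cs s => [//|c cs IH] s /= [[lev _ _ _ _] _ ok] ow.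
have sw : carve s c w = s w.
  have evC : w \in cluster c ++ boundary c -> False.
    by move/lev => e; rewrite e odd_double in ow.
  rewrite mem_cat in evC; rewrite /carve.
  by do 2![case: ifP => [wC|_]; first by case: evC; rewrite wC ?orbT].
by rewrite IH // sw.
Qed.

Lemma carve_seq_leq s cs w :
  carvable_seq E L r v s cs -> s w <= foldl carve s cs w.
Proof.
elim: cs s => [//|c cs IH] s /= [[lev _ _ _ _] _ ok].
apply: leq_trans (IH _ ok); rewrite /carve.
case: ifP => [wC|_]; first by rewrite lev // mem_cat wC.
case: ifP => [wD|//]; rewrite lev ?leqW // mem_cat wD orbT //.
Qed.

Definition touched (cs : seq carving) (w : nat) : bool :=
  has (fun c => w \in cluster c ++ boundary c) cs.

Lemma carve_seq_untouched s cs w : ~~ touched cs w -> foldl carve s cs w = s w.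
Proof.
elim: cs s => [//|c cs IH] s /=; rewrite negb_or mem_cat negb_or => /andP[/andP[wC wD] wcs].
by rewrite IH // /carve (negbTE wC) (negbTE wD).
Qed.

Lemma touched_near s cs w :
  carvable_seq E L r v s cs -> touched cs w -> reach E r.+1 v w.
Proof.
elim: cs s => [//|c cs IH] s /= [_ [near near'] ok] /orP[|/(IH _ ok)//].
by rewrite mem_cat => /orP[/near|/near'//]; exact: reach_leq.
Qed.

Lemma carving_inv_carve_seq (S : seq nat) s cs :
  uniq S -> symmetric E -> (forall w, reach E r.+1 v w -> w \in S) ->
  carvable_seq E L r v s cs -> carving_inv S E L s ->
  carving_inv S E L (foldl carve s cs).
Proof.
move=> uS symE nearS; elim: cs s => [//|c cs IH] s /= [car [near near'] ok] inv.
apply: IH => //; apply: carving_inv_carve => // w.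
by rewrite mem_cat => /orP[/near|/near'] wv; apply: nearS => //; exact: reach_leq wv.
Qed.

Lemma carve_seq_eq s s' cs w : s w = s' w -> foldl carve s cs w = foldl carve s' cs w.
Proof.
by elim: cs s s' => [//|c cs IH] s s' e /=; apply: IH; rewrite /carve e.
Qed.

(** Carvings found in a view remain legitimate in the whole graph: their conditions concern states
    within distance [r.+1] of [v], edges leaving names within distance [r], and reachability, which
    only grows with the edge relation. *)
Lemma carvable_seq_transfer (E' : rel nat) s s' cs :
  subrel E E' -> (forall w z, reach E r v w -> E' w z -> E w z) ->
  (forall w, reach E r.+1 v w -> s w = s' w) ->
  carvable_seq E L r v s cs -> carvable_seq E' L r v s' cs.
Proof.
move=> EE' E'E; elim: cs s s' => [//|c cs IH] s s' ss' /=.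
move=> [[lev uC sz [u Cu] closed] [near near'] ok]; split.
- split=> //.
  + move=> w wCD; rewrite -ss' ?lev //; move: wCD; rewrite mem_cat.
    by case/orP => [/near|/near'//]; exact: reach_leq.
  + by exists u => w /Cu; exact: sub_reach.
  + move=> w z wC wz; have wz' := E'E _ _ (near _ wC) wz.
    rewrite -ss'; first exact: closed wC wz'.
    by rewrite -addn1; apply: reach_trans (near _ wC) (reach1 wz').
- by split=> w; [move/near|move/near']; exact: sub_reach.
- by apply: IH ok => w /ss' e; rewrite /carve e.
Qed.

End CarvableSeq.

(** * Carving as an SLOCAL algorithm *)

Definition log_floor (n : nat) : nat := trunc_log 2 n.

Lemma log_floor_bounds n : 0 < n -> 2 ^ log_floor n <= n < 2 ^ (log_floor n).+1.
Proof. exact: trunc_log_bounds. Qed.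

(** The radius given by [carvable_exists] at the highest level, [i = L]. *)
Definition carving_radius (n : nat) : nat :=
  log_floor n * (log_floor n).+1 + log_floor n.

(** Twice the reach of a carving: a node then sees every node whose carvings may have touched the
    same names as its own. *)
Definition carving_locality (n : nat) : nat := (carving_radius n).+1.*2.

Section CarvingAlg.
Variable a : nat.

Local Notation cview := (view unit nat (nat -> nat)).

Definition stored (m : option (nat * (nat -> nat))) (j : nat) : nat :=
  if m is Some (_, tau) then tau j else 0.

(** A view is a partial function on [nat]; its domain can be listed because valid identifiers are
    below [n ^ a]. *)
Definition view_names (n : nat) (V : cview) : seq nat :=
  [seq j <- iota 0 (n ^ a) | isSome (view_node V j)].

(* States only increase, so the current one is the maximum of the stored ones. *)
Definition view_state (n : nat) (V : cview) (j : nat) : nat :=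
  \max_(i <- view_names n V) if view_node V i is Some (_, m) then stored m j else 0.

Definition good_carvings (n : nat) (V : cview) (cs : seq carving) : Prop :=
  let s := view_state n V in let v := view_center V in
  carvable_seq (view_edge V) (log_floor n) (carving_radius n) v s cs /\
  odd (foldl carve s cs v) || ((log_floor n).*2 < foldl carve s cs v).

Definition carvings_of (n : nat) (V : cview) : seq carving :=
  if pselect (exists cs, good_carvings n V cs) is left h then sval (cid h) else [::].

(** A node writes only in its own memory, so it records there the new states of all names touched by
    its carvings. The factor [n ^ a] makes labels compare colors first. *)
Definition carving_alg : slocal_alg unit nat :=
  @SlocalAlg unit nat (nat -> nat) (fun n V =>
    let cs := carvings_of n V in
    let s := foldl carve (view_state n V) cs in
    ((s (view_center V))./2 * n ^ a + view_center V,
     fun j => if touched cs j then s j else 0)).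

(** * Correctness of the carving run *)

Section Run.
Variables (G : sgraph) (id : G -> nat) (x : G -> unit).
Hypothesis vid : valid_ids a id.

Let id_inj : injective id := vid.1.
Local Notation n := #|G|.
Local Notation L := (log_floor n).
Local Notation radius := (carving_radius n).
Local Notation mem := (G -> option (nat * (nat -> nat))).

Definition id_edge : rel nat := fun j k =>
  [exists u : G, exists w : G, [&& adj u w, id u == j & id w == k]].

Lemma id_edgeP j k :
  reflect (exists u w : G, [/\ adj u w, id u = j & id w = k]) (id_edge j k).
Proof.
apply: (iffP existsP) => [[u /existsP[w /and3P[uw /eqP uj /eqP wk]]]|[u [w [uw <- <-]]]].
  by exists u, w.
by exists u; apply/existsP; exists w; rewrite uw !eqxx.
Qed.

Lemma id_edgeE u w : id_edge (id u) (id w) = adj u w.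
Proof.
apply/id_edgeP/idP => [[u' [w' [uw /id_inj <- /id_inj <-//]]]|uw].
by exists u, w.
Qed.

Lemma id_edge_sym : symmetric id_edge.
Proof.
by move=> j k; apply/id_edgeP/id_edgeP => -[u [w [uw <- <-]]]; exists w, u; rewrite adj_sym.
Qed.

Lemma reach_id r u j :
  reach id_edge r (id u) j -> exists2 w, j = id w & reach (@adj G) r u w.
Proof.
move=> [p [+ <- +]]; elim: p r u => [|k p IH] r u /=.
  by exists u => //; exact: reach_refl.
move=> /andP[/id_edgeP[u' [w [uw /id_inj eu <-]]] wp]; rewrite eu in uw.
case: r => // r /(IH _ _ wp)[z -> wz]; exists z => //.
by rewrite -add1n; apply: reach_trans (reach1 uw) wz.
Qed.

Definition names : seq nat := map id (enum G).

Lemma mem_names u : id u \in names.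
Proof. by rewrite map_f ?mem_enum. Qed.

Lemma size_names : size names = n.
Proof. by rewrite size_map -cardE. Qed.

Lemma names_uniq : uniq names.
Proof. by rewrite map_inj_uniq ?enum_uniq. Qed.

Definition global_state (m : mem) (j : nat) : nat := \max_(u : G) stored (m u) j.

(** Records stay close to their holder, which lets later nodes recover the current states from their
    views. Outputs can refer to the current state because clustered names keep theirs. *)
Record run_inv (m : mem) : Prop := {
  run_carving_inv : carving_inv names id_edge L (global_state m);
  run_stored : forall u j, stored (m u) j != 0 ->
    exists2 w, j = id w & reach (@adj G) radius.+1 u w;
  run_output : forall u o tau, m u = Some (o, tau) ->
    odd (global_state m (id u)) /\
    o = (global_state m (id u))./2 * n ^ a + id u }.

Section Step.
Variables (m : mem) (v : G).
Hypotheses (inv : run_inv m) (mv : m v = None).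

Local Notation V := (view_of id x (carving_locality n) m v).

Lemma view_node_id w : view_node V (id w) =
  if Defs.within (carving_locality n) v w then Some (x w, m w) else None.
Proof.
rewrite /=; case: pickP => [z /andP[vz /eqP/id_inj e]|none] /=; first by rewrite -e vz.
by have := none w; rewrite eqxx andbT => ->.
Qed.

Lemma mem_view_names j :
  (j \in view_names n V) = [exists w, Defs.within (carving_locality n) v w && (id w == j)].
Proof.
rewrite mem_filter mem_iota; apply/idP/existsP => [/andP[/= + _]|[w /andP[vw /eqP <-]]].
  by case: pickP => // w vw _; exists w.
by rewrite view_node_id vw /= vid.2.
Qed.

(** Any nonzero record about [w] is held within distance [radius.+1] of [w], hence within the
    locality of [v]. *)
Lemma view_state_near w : reach (@adj G) radius.+1 v w ->
  view_state n V (id w) = global_state m (id w).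
Proof.
move=> vw; apply/eqP; rewrite eqn_leq; apply/andP; split.
  apply/bigmax_leqP_seq => j; rewrite mem_view_names => /existsP[u /andP[vu /eqP <-]] _.
  by rewrite view_node_id vu; exact: leq_bigmax.
apply/bigmax_leqP => u _; have [->//|] := eqVneq (stored (m u) (id w)) 0.
move=> /(run_stored inv)[w' /id_inj <- uw].
have vu : Defs.within (carving_locality n) v u.
  apply/withinP; rewrite /carving_locality -addnn; apply: reach_trans vw _.
  by apply: reach_sym uw; exact: adj_sym.
have uV : id u \in view_names n V.
  by rewrite mem_view_names; apply/existsP; exists u; rewrite vu eqxx.
rewrite /view_state (big_rem _ uV) view_node_id vu.
exact: leq_maxl.
Qed.

Lemma view_edge_sub : subrel (view_edge V) id_edge.
Proof.
move=> j k /existsP[u /existsP[w /and5P[_ _ uw /eqP uj /eqP wk]]].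
by apply/id_edgeP; exists u, w.
Qed.

Lemma view_edge_near u w : reach (@adj G) radius v u -> adj u w -> view_edge V (id u) (id w).
Proof.
move=> vu uw; apply/existsP; exists u; apply/existsP; exists w.
rewrite uw !eqxx /= !andbT; apply/andP; split; apply/withinP.
  by apply: reach_leq vu; rewrite /carving_locality -addnn (leq_trans (leqnSn _)) ?leq_addr.
have : reach (@adj G) (radius + 1) v w by apply: reach_trans vu (reach1 uw).
by apply: reach_leq; rewrite addn1 /carving_locality -addnn leq_addr.
Qed.

Local Notation cs := (carvings_of n V).
Local Notation s' := (foldl carve (global_state m) cs).

Lemma card_pos : 0 < n.
Proof. by apply/card_gt0P; exists v. Qed.

(** The existence result is applied to the view as a graph of its own, which has at most [n]
    names. *)
Lemma good_carvings_of : good_carvings n V cs.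
Proof.
rewrite /carvings_of; case: pselect => [h|[]]; first by case: (cid h).
have [||||cs ok fin] := @carvable_seq_exists (view_names n V) (view_edge V) L
  _ _ _ (view_state n V) (id v).
- by rewrite filter_uniq ?iota_uniq.
- move=> j k /existsP[u /existsP[w /and5P[_ vw _ _ /eqP <-]]].
  by rewrite mem_view_names; apply/existsP; exists w; rewrite vw eqxx.
- apply: (@leq_ltn_trans (size names)); last first.
    by rewrite size_names; case/andP: (log_floor_bounds card_pos).
  apply: uniq_leq_size; first by rewrite filter_uniq ?iota_uniq.
  move=> j; rewrite mem_view_names => /existsP[u /andP[_ /eqP <-]]; exact: mem_names.
- rewrite mem_view_names; apply/existsP; exists v; rewrite eqxx andbT.
  by apply/withinP; exact: reach_refl.
by exists cs.
Qed.

Lemma carvable_global :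
  carvable_seq id_edge L radius (id v) (global_state m) cs.
Proof.
have [ok _] := good_carvings_of.
apply: carvable_seq_transfer ok => [|j k /(sub_reach view_edge_sub)/reach_id[u -> vu]|].
- exact: view_edge_sub.
- move=> /id_edgeP[u' [w [uw /id_inj eu <-]]]; rewrite eu in uw; exact: view_edge_near.
- by move=> j /(sub_reach view_edge_sub)/reach_id[w -> /view_state_near].
Qed.

Lemma foldl_view_state w : reach (@adj G) radius.+1 v w ->
  foldl carve (view_state n V) cs (id w) = s' (id w).
Proof. by move=> vw; apply: carve_seq_eq; exact: view_state_near. Qed.

Local Notation m' := (slocal_step (A:=carving_alg) id x (carving_locality n) m v).

Lemma stored_center j : stored (m' v) j = if touched cs j then s' j else 0.
Proof.
rewrite /slocal_step eqxx /=; case: ifP => // tj.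
have /reach_id[w -> vw] := touched_near carvable_global tj.
exact: foldl_view_state.
Qed.

(** [v] held no record before, and its new record dominates the older ones because carving never
    decreases a state. *)
Lemma global_state_step j : global_state m' j = s' j.
Proof.
rewrite /global_state (bigD1 v) //= stored_center.
have -> : \max_(u | u != v) stored (m' u) j = global_state m j.
  rewrite /global_state [RHS](bigD1 v) //= mv max0n.
  by apply: eq_bigr => u uv; rewrite /slocal_step (negbTE uv).
case: ifP => [tj|/negbT tj]; last by rewrite max0n carve_seq_untouched.
by apply/maxn_idPl; exact: carve_seq_leq carvable_global.
Qed.

Lemma carving_inv_step : carving_inv names id_edge L s'.
Proof.
apply: (carving_inv_carve_seq names_uniq id_edge_sym _ carvable_global (run_carving_inv inv)).
by move=> j /reach_id[w -> _]; exact: mem_names.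
Qed.

(** Otherwise [v] would have reached level [L.+1], which requires [2 ^ L.+1] nodes. *)
Lemma center_clustered : odd (s' (id v)).
Proof.
have [_] := good_carvings_of; rewrite foldl_view_state; last exact: reach_refl.
case/orP => // lt; apply: contraT => ev.
have : L.+1.*2 <= s' (id v) by rewrite doubleS; lia.
move/(carving_inv_level carving_inv_step (mem_names v)); rewrite size_names leqNgt.
by case/andP: (log_floor_bounds card_pos) => _ ->.
Qed.

Lemma run_inv_step : run_inv m'.
Proof.
have gs : global_state m' = s' by apply/funext => j; exact: global_state_step.
split; rewrite ?gs.
- exact: carving_inv_step.
- move=> u j; have [->|uv] := eqVneq u v; last first.
    by rewrite /slocal_step (negbTE uv) => /(run_stored inv).
  rewrite stored_center; case: ifP => // tj _.
  exact/reach_id/(touched_near carvable_global tj).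
- move=> u o tau; have [->|uv] := eqVneq u v.
    rewrite /slocal_step eqxx => -[<- _]; split; first exact: center_clustered.
    by rewrite /= foldl_view_state //; exact: reach_refl.
  rewrite /slocal_step (negbTE uv) => /(run_output inv)[ou ->].
  by rewrite (carve_seq_odd carvable_global ou).
Qed.

End Step.

Lemma run_inv0 : run_inv (fun=> None).
Proof.
split=> //.
have -> : global_state (fun=> None) = (fun=> 0).
  by apply/funext => j; rewrite /global_state big1.
exact: carving_inv0.
Qed.

Lemma run_inv_run o : uniq o ->
  run_inv (slocal_run carving_alg id x (carving_locality n) o).
Proof.
elim/last_ind: o => [_|o v IH]; first exact: run_inv0.
rewrite rcons_uniq /slocal_run foldl_rcons => /andP[vo uo].
apply: run_inv_step; first exact: IH.
by rewrite foldl_slocal_step_notin.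
Qed.

Lemma slocal_run_mem o v : v \in o ->
  isSome (slocal_run carving_alg id x (carving_locality n) o v).
Proof.
elim/last_ind: o => [//|o w IH]; rewrite mem_rcons inE slocal_run_rcons.
by case: eqP => //= _ /IH.
Qed.

Definition state_label (s : nat -> nat) (v : G) : nat := (s (id v))./2 * n ^ a + id v.

Lemma state_label_inj s : injective (state_label s).
Proof.
move=> u w /(congr1 (modn^~ (n ^ a))); rewrite /state_label !modnMDl.
by rewrite !modn_small ?vid.2 //; exact: id_inj.
Qed.

Lemma state_label_reach s u p : carving_inv names id_edge L s ->
  (forall w, odd (s (id w))) ->
  path (@adj G) u p -> sorted ltn (map (state_label s) (u :: p)) ->
  reach (@adj G) (5 * L ^ 2) u (last u p).
Proof.
move=> cinv odd_s up lt_p.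
have [] := carving_path (N := n ^ a) id_edge_sym cinv (u := id u) (p := map id p).
- by rewrite path_map; apply: sub_path up => y z /=; rewrite id_edgeE.
- by move=> _ /(@mapP _ _ id (u :: p))[w _ ->]; rewrite vid.2.
- by rewrite -map_cons -map_comp.
rewrite last_map => _ /reach_id[w /id_inj <-]; apply: reach_leq.
have : (s (id (last u p)))./2 <= L.
  have n0 : 0 < n by apply/card_gt0P; exists u.
  case/andP: (log_floor_bounds n0) => _ ltn; rewrite -ltnS.
  rewrite -(@ltn_exp2l 2) //; apply: leq_ltn_trans ltn; rewrite -size_names.
  apply: (carving_inv_level cinv (mem_names (last u p))).
  by rewrite -[X in _ <= X]odd_double_half leq_addl.
(* [carving_path] yields at most [2 * L ^ 2 + 3 * L], and this is at most [5 * L ^ 2] for every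
   natural [L]. *)
by case: (log_floor n) => [|l]; nia.
Qed.

End Run.
End CarvingAlg.

(** Of two nodes on an increasing path one comes first, and the segment between them is again an
    increasing path. *)
Lemma diameter_ordering_state_label (R : realType) (D : R) a (G : sgraph) (id : G -> nat) s :
  valid_ids a id -> carving_inv (names id) (id_edge id) (log_floor #|G|) s ->
  (forall w, odd (s (id w))) -> ((5 * log_floor #|G| ^ 2)%:R <= D)%R ->
  diameter_ordering D (state_label a id s).
Proof.
move=> vid cinv odd_s LD; split; first exact: state_label_inj.
move=> u p up lt_p v w vp wp; exists (5 * log_floor #|G| ^ 2) => //; apply/withinP.
have fwd y q : path (@adj G) y q -> sorted ltn (map (state_label a id s) (y :: q)) ->
    reach (@adj G) (5 * log_floor #|G| ^ 2) y (last y q).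
  exact: state_label_reach.
case/splitPl: vp up lt_p wp => p1 p2 <-; rewrite cat_path map_cons map_cat /= cat_path last_map.
move=> /andP[up1 vp2] /andP[lt1 lt2]; rewrite -cat_cons mem_cat => /orP[wp1|wp2].
  case/splitPl: wp1 up1 lt1 => q1 q2 <-; rewrite cat_path last_cat map_cat cat_path last_map.
  move=> /andP[_ wq2] /andP[_ ltq2]; apply: reach_sym; first exact: adj_sym.
  exact: fwd.
have wp2' : w \in last u p1 :: p2 by rewrite inE wp2 orbT.
case/splitPl: wp2' vp2 lt2 => q1 q2 <-; rewrite cat_path map_cat cat_path.
by move=> /andP[vq1 _] /andP[ltq1 _]; exact: fwd.
Qed.

Lemma slocal_diameter_ordering (R : realType) a (d : nat -> R) :
  (forall n : nat, 0 < n -> ((5 * log_floor n ^ 2)%:R <= d n)%R) ->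
  SLOCAL a carving_locality (diameter_ordering_problem d).
Proof.
move=> dL; exists (carving_alg a) => G id x order vid perm.
have mem_order v : v \in order by rewrite (perm_mem perm) mem_enum.
have inv := run_inv_run x vid (eq_ind_r is_true (enum_uniq G) (perm_uniq perm)).
set m := slocal_run _ _ _ _ _ in inv *.
have out v : exists tau,
    m v = Some (state_label a id (global_state m) v, tau) /\ odd (global_state m (id v)).
  have : isSome (m v) by exact: slocal_run_mem.
  case mv : (m v) => [[y tau]|] // _; have [ov ->] := run_output inv mv.
  by exists tau.
exists (state_label a id (global_state m)); split.
  by move=> v; have [tau [-> _]] := out v.
(* The lower bound on [d] is available for nonempty graphs; without nodes both conditions are
   vacuous. *)
have [v|G0] := pickP (predT : pred G).
  move=> _; apply: diameter_ordering_state_label => //; first exact: run_carving_inv inv.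
    by move=> w; have [tau []] := out w.
  by apply: dL; apply/card_gt0P; exists v.
by split=> [u|u]; have := G0 u.
Qed.

Local Open Scope ring_scope.

(** * Polylogarithmic bounds *)

Section Polylog.
Context {R : realType}.
Implicit Types f g : nat -> R.

Lemma near_ln_ge (M : R) : \forall n \near \oo%classic, M <= ln (n%:R : R).
Proof.
near=> n; have Mn : expR M <= n%:R by near: n; exact: nbhs_infty_ger.
by rewrite -[M]expRK ler_ln ?posrE ?expR_gt0 // (lt_le_trans _ Mn) ?expR_gt0.
Unshelve. all: by end_near. Qed.

Lemma polylogD f g : polylog f -> polylog g -> polylog (fun n => f n + g n).
Proof.
(* The additional factor [ln n], eventually at least 2, absorbs the two summands. *)
move=> [k fk] [l gl]; exists (k + l).+1; near=> n.
have ln2 : 2 <= ln (n%:R : R) by near: n; exact: near_ln_ge.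
have ln1 : 1 <= ln (n%:R : R) by lra.
have fn : f n <= ln n%:R ^+ k by near: n.
have gn : g n <= ln n%:R ^+ l by near: n.
have kn : ln (n%:R : R) ^+ k <= ln n%:R ^+ (k + l) by apply: ler_weXn2l; rewrite ?leq_addr.
have ln' : ln (n%:R : R) ^+ l <= ln n%:R ^+ (k + l) by apply: ler_weXn2l; rewrite ?leq_addl.
apply: (@le_trans _ _ (2 * ln n%:R ^+ (k + l))); first by lra.
by rewrite exprS ler_wpM2r // exprn_ge0 // (le_trans ler01).
Unshelve. all: by end_near. Qed.

Lemma polylogM f g : (forall n, 0 <= f n) -> (forall n, 0 <= g n) ->
  polylog f -> polylog g -> polylog (fun n => f n * g n).
Proof.
move=> f0 g0 [k fk] [l gl]; exists (k + l)%N; near=> n.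
by rewrite exprD; apply: ler_pM => //; near: n.
Unshelve. all: by end_near. Qed.

Lemma polylog_cst (M : R) : polylog (fun=> M).
Proof.
exists 1; near=> n; rewrite expr1; near: n; exact: near_ln_ge.
Unshelve. all: by end_near. Qed.

Lemma polylog_truncn f : polylog f -> polylog (fun n => (Num.truncn (f n))%:R : R).
Proof.
move=> [k fk]; exists k; near=> n.
have ln0 : 0 <= ln (n%:R : R) by near: n; exact: near_ln_ge.
have fn : f n <= ln n%:R ^+ k by near: n.
have [f0|f0] := leP 0 (f n); first by apply: le_trans fn; rewrite truncn_le.
rewrite (_ : Num.truncn _ = 0%N) ?exprn_ge0 //; apply/truncn0Pn.
by rewrite -ltNge (lt_trans f0).
Unshelve. all: by end_near. Qed.

Lemma polylog_natD (s t : nat -> nat) : polylog (fun n => (s n)%:R : R) ->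
  polylog (fun n => (t n)%:R : R) -> polylog (fun n => (s n + t n)%:R : R).
Proof.
move=> sp tp; rewrite (_ : (fun n => _) = fun n => (s n)%:R + (t n)%:R); last first.
  by apply/funext => n; rewrite natrD.
exact: polylogD.
Qed.

Lemma polylog_natM (s t : nat -> nat) : polylog (fun n => (s n)%:R : R) ->
  polylog (fun n => (t n)%:R : R) -> polylog (fun n => (s n * t n)%:R : R).
Proof.
move=> sp tp; rewrite (_ : (fun n => _) = fun n => (s n)%:R * (t n)%:R); last first.
  by apply/funext => n; rewrite natrM.
by apply: polylogM => // n; rewrite ler0n.
Qed.

Lemma polylog_natS (s : nat -> nat) : polylog (fun n => (s n)%:R : R) ->
  polylog (fun n => (s n).+1%:R : R).
Proof.
move=> sp; apply: (@polylog_natD (fun=> 1%N)) sp; exact: polylog_cst.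
Qed.

Lemma log_floor_ln n : (0 < n)%N -> (log_floor n)%:R * ln 2 <= ln (n%:R : R).
Proof.
move=> n0; have /andP[le _] := log_floor_bounds n0.
rewrite mulr_natl -lnXn //.
by rewrite ler_ln ?posrE ?exprn_gt0 ?ltr0n // -natrX ler_nat.
Qed.

Lemma ln2_gt0 : 0 < ln 2 :> R.
Proof. by rewrite ln_gt0 // ltr1n. Qed.

Lemma polylog_log_floor : polylog (fun n => (log_floor n)%:R : R).
Proof.
(* One factor [ln n] absorbs the constant [(ln 2)^-1]. *)
exists 2; near=> n.
have n0 : (0 < n)%N by near: n; exact: nbhs_infty_gt.
have l2 := ln2_gt0.
have lnM : (ln 2)^-1 <= ln (n%:R : R) by near: n; exact: near_ln_ge.
have ln0 : 0 <= ln (n%:R : R) by apply: le_trans lnM; rewrite invr_ge0 ltW.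
have := log_floor_ln n0; rewrite -ler_pdivlMr // => /le_trans; apply.
by rewrite expr2 ler_wpM2l.
Unshelve. all: by end_near. Qed.

Lemma polylog_carving_locality : polylog (fun n => (carving_locality n)%:R : R).
Proof.
have L := polylog_log_floor.
have radius : polylog (fun n => (carving_radius n)%:R : R).
  by apply: polylog_natD => //; apply: polylog_natM => //; exact: polylog_natS.
have S : polylog (fun n => (carving_radius n).+1%:R : R) by exact: polylog_natS.
rewrite (_ : (fun n => _) = fun n => ((carving_radius n).+1 + (carving_radius n).+1)%:R).
  exact: polylog_natD.
by apply/funext => n; rewrite addnn.
Qed.

End Polylog.

Theorem theorem1p4 (R : realType) :
  exists c : R, 0 < c /\
    forall (a : nat) (d : nat -> R),
      (1 <= a)%N ->
      (forall n : nat, (1 <= n)%N -> c * ln n%:R ^+ 2 <= d n) ->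
      polylog d ->
      P_SLOCAL_complete R a (diameter_ordering_problem d).
Proof.
have l2 := @ln2_gt0 R.
(* Carving achieves [5 * log_floor n ^ 2], and [log_floor n] is at most [ln n / ln 2]. *)
exists (5 / ln 2 ^+ 2); split; first by rewrite divr_gt0 // exprn_gt0.
move=> a d _ d_ge d_polylog; split.
  exists carving_locality; split; first exact: polylog_carving_locality.
  apply: slocal_diameter_ordering => n n0; apply: le_trans (d_ge n n0).
  rewrite natrM natrX mulrAC -mulrA ler_wpM2l // ler_pdivlMr ?exprn_gt0 // -exprMn.
  rewrite ler_pXn2r ?nnegrE ?ln_ge0 ?ler1n //; first exact: log_floor_ln.
  by rewrite mulr_ge0 // ltW.
move=> Q [r [r_polylog Qr]] [t [t_polylog ordt]].
exists (fun n => (r n * t n).+1 + r n + Num.truncn (d n) * r n)%N; split.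
  apply: polylog_natD; last by apply: polylog_natM => //; exact: polylog_truncn.
  by apply: polylog_natD => //; apply: polylog_natS; exact: polylog_natM.
exact: ordering_local_hard ordt Qr.
Qed.
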